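(* Let $k$ be an arbitrary field, $S=k[x,y,z,w]$ the polynomial ring in four variables, and $f=xyz+xyw+xzw+yzw$ (the Cayley cubic). For $q\in\mathbb{N}$ let $\theta=S/(f,x^q,y^q,z^q,w^q)=\bigoplus_i\theta_i$. The socle degree $a(q)=\max\{i:\theta_i\neq0\}$ of the artinian ring $\theta$ is $$a(q)=\begin{cases}0 & \text{if } q=1,\\ 2q-1 & \text{if } q>1,\end{cases}$$ and the value of the generalized Hilbert-Kunz function of Cayley's cubic at every $q\in\mathbb{N}$ is $$\dim_k S/(f,x^q,y^q,z^q,w^q)=2q^3-q.$$
   Context: $S$ carries the standard grading and $\theta$ the induced grading. Here $\mathbb{N}=\{0,1,2,\dots\}$; $q$ is any nonnegative integer, not necessarily a power of the characteristic, and $k$ may have any characteristic (including $0$). *)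

(* Defs.v *)
From HB Require Import structures.
From mathcomp Require Import all_boot all_order all_algebra.
From mathcomp Require Import boolp.
From mathcomp Require Import mpoly.

Set Implicit Arguments.
Unset Strict Implicit.
Unset Printing Implicit Defensive.

Import GRing.Theory.
Local Open Scope ring_scope.
Local Open Scope quotient_scope.

Section GeneratedIdeal.
Variables (R : comNzRingType) (A : comAlgType R) (m : nat) (g : m.-tuple A).

(* The library forms quotients by boolean predicates only; ideal membership
   not being decidable in general, we take its classical truth value. *)
Definition gen_ideal : {pred A} :=
  fun p => `[< exists a : 'I_m -> A, p = \sum_(i < m) a i * tnth g i >].

Lemma gen_ideal_submod_closed : submod_closed gen_ideal.
Proof.
split=> [|c p r /asboolP[a ->] /asboolP[b ->]]; apply/asboolP.
  by exists (fun=> 0); rewrite big1 // => i _; rewrite mul0r.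
exists (fun i => c *: a i + b i).
rewrite scaler_sumr -big_split /=; apply: eq_bigr => i _.
by rewrite mulrDl scalerAl.
Qed.

HB.instance Definition _ :=
  GRing.isSubmodClosed.Build R A gen_ideal gen_ideal_submod_closed.

(* The library's {ideal_quot _} has a ring structure for proper ideals only. We
   need just its module structure, which also covers the unit ideal. *)
Definition quot_gen := {ideal_quot gen_ideal}.

HB.instance Definition _ := Quotient.on quot_gen.
HB.instance Definition _ := GRing.Zmodule.on quot_gen.

Definition quot_gen_scale (c : R) (u : quot_gen) : quot_gen :=
  \pi_quot_gen (c *: repr u).

Lemma pi_quot_gen_eq (p r : A) :
  (\pi_quot_gen p == \pi_quot_gen r) = (p - r \in gen_ideal).
Proof. by rewrite Quotient.idealrBE. Qed.

Lemma quot_gen_scale_pi c (p : A) :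
  quot_gen_scale c (\pi_quot_gen p) = \pi_quot_gen (c *: p).
Proof.
apply/eqP; rewrite pi_quot_gen_eq -scalerBr rpredZ //.
by rewrite -pi_quot_gen_eq reprK.
Qed.

Lemma pi_quot_genD (p r : A) :
  \pi_quot_gen (p + r) = \pi_quot_gen p + \pi_quot_gen r.
Proof. exact: (Quotient.pi_add gen_ideal p r). Qed.

Lemma quot_gen_scaleA c d u :
  quot_gen_scale c (quot_gen_scale d u) = quot_gen_scale (c * d) u.
Proof. by elim/(@quotW _ quot_gen): u => p; rewrite !quot_gen_scale_pi scalerA. Qed.

Lemma quot_gen_scale1 : left_id 1 quot_gen_scale.
Proof. by elim/(@quotW _ quot_gen) => p; rewrite quot_gen_scale_pi scale1r. Qed.

Lemma quot_gen_scaleDr : right_distributive quot_gen_scale +%R.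
Proof.
move=> c u v; elim/(@quotW _ quot_gen): u => p; elim/(@quotW _ quot_gen): v => r.
by rewrite -pi_quot_genD !quot_gen_scale_pi scalerDr pi_quot_genD.
Qed.

Lemma quot_gen_scaleDl u : {morph quot_gen_scale^~ u : c d / c + d}.
Proof.
move=> c d; elim/(@quotW _ quot_gen): u => p.
by rewrite !quot_gen_scale_pi scalerDl pi_quot_genD.
Qed.

HB.instance Definition _ := GRing.Zmodule_isLmodule.Build R quot_gen
  quot_gen_scaleA quot_gen_scale1 quot_gen_scaleDr quot_gen_scaleDl.
End GeneratedIdeal.

(* This says that V can be given a vectType structure of dimension n. *)
Definition has_dim (k : fieldType) (V : lmodType k) (n : nat) : Prop :=
  inhabited (Vector.axiom n V).

Section Cayley.
Variables (k : fieldType) (q : nat).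

Local Notation S := {mpoly k[4]}.

Definition varX : S := 'X_(inord 0).
Definition varY : S := 'X_(inord 1).
Definition varZ : S := 'X_(inord 2).
Definition varW : S := 'X_(inord 3).

Definition cayley : S :=
  varX * varY * varZ + varX * varY * varW
  + varX * varZ * varW + varY * varZ * varW.

Definition theta : lmodType k :=
  quot_gen [tuple cayley; varX ^+ q; varY ^+ q; varZ ^+ q; varW ^+ q].

Definition in_theta (p : S) : theta := \pi p.

Definition theta_homog (i : nat) (t : theta) : Prop :=
  exists2 p : S, p \is i.-homog & t = in_theta p.

Definition theta_neq0 (i : nat) : Prop :=
  exists2 t : theta, theta_homog i t & t != 0.

Definition socle_degree (a : nat) : Prop :=
  theta_neq0 a /\ forall i : nat, theta_neq0 i -> (i <= a)%N.
End Cayley.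

(* Main.v *)
Require Import Defs.
From HB Require Import structures.
From mathcomp Require Import all_boot all_order all_algebra.
From mathcomp Require Import boolp mpoly zify.

(** Let A = k[x,y,z,w]/(x^q,y^q,z^q,w^q), with basis the monomials of the box
    [0,q-1]^4. Multiplication by f raises degrees by 3 and has maximal rank:
    it is injective in degrees <= 2q-4 and surjective onto degrees >= 2q. The
    reflection u |-> (q-1,q-1,q-1,q-1) - u of the box exchanges the two claims.
    Surjectivity is dual to the vanishing of every function phi that is
    supported on box monomials of degree >= 2q and satisfies
    sum_l phi(u + (1,1,1,1) - e_l) = 0 for all u; this holds by induction from
    q - 2 to q: shifting phi by (1,1,1,1) shows that phi vanishes in the
    interior, and then the relation determines it on the boundary. Hence theta
    vanishes in degrees >= 2q, and its dimension is the number of points of the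
    box of degree 2q-3, 2q-2 or 2q-1. In degree 2q-1 the monomial (xy)^(q-1) z
    survives, because every element of the ideal has the same coefficient at
    (xy)^(q-1) z and at (xy)^(q-1) w. *)

Section CayleyCubic.
Set Implicit Arguments.
Unset Strict Implicit.
Unset Printing Implicit Defensive.
Import GRing.Theory.
Local Open Scope ring_scope.
Local Open Scope quotient_scope.

(** * Vanishing of functions on the box that satisfy the face relations *)

(* The Cayley cubic is the sum of the monomials 'X_[face l]. *)
Definition face (l : 'I_4) : 'X_{1..4} := [multinom (j != l : nat) | j < 4].

Lemma face_sum_eq0 (V : nmodType) (q : nat) (phi : 'X_{1..4} -> V) :
    (forall m, phi m != 0 -> (forall i, (m i < q)%N) /\ (2 * q <= mdeg m)%N) ->
    (forall u, \sum_l phi (face l + u)%MM = 0) ->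
  forall m, phi m = 0.
Proof.
elim/ltn_ind: q phi => q IHq phi suppP sumP.
have out (m : 'X_{1..4}) i : (q <= m i)%N -> phi m = 0.
  move=> le_q_mi; apply/eqP/contraT => /suppP[/(_ i)]; lia.
have alone l (u : 'X_{1..4}) : (forall j, j != l -> phi (face j + u)%MM = 0) ->
    phi (face l + u)%MM = 0.
  by move=> others; have := sumP u; rewrite (bigD1 l) //= big1 ?addr0.
have [q_le1|q_gt1] := leqP q 1.
  move=> m; apply/eqP/contraT => /suppP[lt_m]; rewrite mdegE big1 => [|i _].
    move: (lt_m ord0); lia.
  by move: (lt_m i); lia.
pose one : 'X_{1..4} := [multinom 1%N | j < 4].
have inner (m : 'X_{1..4}) : phi (one + m)%MM = 0.
  apply: (IHq (q - 2)%N _ (fun m => phi (one + m)%MM)) => [|{}m nz_m|u].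
  - lia.
  - have [_ deg_m] := suppP _ nz_m.
    split=> [i|]; last first.
      by move: deg_m; rewrite mdegD [mdeg one]mdegE !big_ord_recl big_ord0 !mnmE; lia.
    rewrite ltnNge; apply: contraNN nz_m => le_m; apply/eqP.
    (* In the relation at [U_(i) + m] every other term has exponent at least q at i. *)
    have ->: (one + m = face i + (U_(i) + m))%MM.
      by apply/mnmP => j; rewrite !mnmDE mnm1E !mnmE eq_sym addnA; case: (i == j).
    apply: alone => j ne_ji; apply: (out _ i).
    rewrite !mnmDE mnm1E !mnmE eqxx eq_sym ne_ji; lia.
  - rewrite -[RHS](sumP (one + u)%MM); apply: eq_bigr => l _.
    by congr phi; apply/mnmP => j; rewrite !mnmDE addnCA.
have innerP (m : 'X_{1..4}) : (forall i, 0 < m i)%N -> phi m = 0.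
  move=> m_gt0; rewrite -(inner (m - one)%MM); congr phi.
  by apply/mnmP => j; rewrite mnmDE mnmBE mnmE subnKC.
move=> m; apply/eqP/contraT => nz_m; have [lt_m deg_m] := suppP _ nz_m.
suff phi_m0 : phi m = 0 by rewrite phi_m0 eqxx in nz_m.
have [/'exists_eqP[i mi0]|] := boolP [exists i, m i == 0%N]; last first.
  rewrite negb_exists => /forallP m_gt0; apply: innerP => i.
  by rewrite lt0n.
(* Two of the remaining exponents add up to at most 2q - 2, so a degree of at least 2q leaves at
   least 2 for the third. *)
have m_ge2 j : j != i -> (2 <= m j)%N.
  move=> ne_ji; move: deg_m; rewrite mdegE (bigD1 i) //= (bigD1 j) //= mi0 add0n.
  have : (\sum_(l < 4 | (l != i) && (l != j)) m l <=
          \sum_(l < 4 | (l != i) && (l != j)) (q - 1))%N.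
    by apply: leq_sum => l _; move: (lt_m l); lia.
  rewrite sum_nat_const.
  have -> : #|[pred l : 'I_4 | (l != i) && (l != j)]| = 2%N.
    apply/eqP; rewrite -(eqn_add2l #|pred2 i j|) card2 (eq_sym i j) ne_ji /=.
    rewrite -[X in _ == X](card_ord 4) -(cardC (pred2 i j)) card2 (eq_sym i j) ne_ji.
    by rewrite eqn_add2l; apply/eqP/eq_card => l; rewrite !inE negb_or.
  by set A := (\sum_(l < 4 | _) _)%N; lia.
(* In the relation at [m - face i] the other three terms have only positive exponents, so they
   vanish by [innerP]. *)
have -> : m = (face i + (m - face i))%MM.
  apply/mnmP => j; rewrite mnmDE mnmBE mnmE.
  by case: eqVneq => [//|/m_ge2]; lia.
apply: alone => j ne_ji; apply: innerP => l.
rewrite mnmDE mnmBE !mnmE; case: (eqVneq l i) => [->|/m_ge2]; last lia.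
by rewrite eq_sym ne_ji.
Qed.

(** * Rank of a matrix whose nonzero entries lie in two blocks, L x H^c and L^c x H *)

Section RankSplit.
Variables (F : fieldType) (n : nat) (M : 'M[F]_n) (L H : {set 'I_n}).
Hypothesis M_LH : forall i j, i \in L -> j \in H -> M i j = 0.
Hypothesis M_LcHc : forall i j, i \notin L -> j \notin H -> M i j = 0.
Hypothesis M_injL : forall g : 'rV_n,
  (forall i, i \notin L -> g 0 i = 0) -> g *m M = 0 -> g = 0.
Hypothesis M_injH : forall h : 'cV_n,
  (forall i, i \notin H -> h i 0 = 0) -> M *m h = 0 -> h = 0.

(** Right multiplication by this matrix extends a vector on A by zero; its transpose restricts to
    A. *)
Definition coord_incl (A : {set 'I_n}) : 'M[F]_(#|A|, n) := rowsub enum_val 1%:M.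
Definition coord_part (A : {set 'I_n}) (x : 'rV[F]_n) : 'rV[F]_n :=
  \row_j (if j \in A then x 0 j else 0).

Lemma mul_incl_supp (A : {set 'I_n}) (x : 'rV[F]_#|A|) i :
  i \notin A -> (x *m coord_incl A) 0 i = 0.
Proof.
move=> iA; rewrite mxE big1 // => j _; rewrite !mxE.
case: eqP => [ji|_]; last by rewrite mulr0.
by move: (enum_valP j); rewrite ji (negPf iA).
Qed.

Lemma mul_incl_tr (A : {set 'I_n}) (x : 'rV[F]_n) :
  x *m (coord_incl A)^T = \row_j x 0 (enum_val j).
Proof.
apply/rowP => j; rewrite !mxE (bigD1 (enum_val j)) //= !mxE eqxx mulr1.
rewrite big1 ?addr0 // => i ne_i; rewrite !mxE eq_sym (negPf ne_i) mulr0 //.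
Qed.

Lemma incl_incl_tr (A : {set 'I_n}) : coord_incl A *m (coord_incl A)^T = 1%:M.
Proof.
apply/row_matrixP => i; rewrite row_mul mul_incl_tr.
by apply/rowP => j; rewrite !mxE (inj_eq enum_val_inj).
Qed.

Lemma part_sub (A : {set 'I_n}) x : (coord_part A x <= coord_incl A)%MS.
Proof.
apply/submxP; exists (\row_j x 0 (enum_val j)); apply/rowP => i.
rewrite mxE; case: ifP => [iA|/negbT iA]; last by rewrite mul_incl_supp.
rewrite mxE (bigD1 (enum_rank_in iA i)) //= !mxE enum_rankK_in // eqxx mulr1.
rewrite big1 ?addr0 // => j ne_j; rewrite !mxE.
case: eqP => [ji|]; last by rewrite mulr0.
by case/eqP: ne_j; apply: enum_val_inj; rewrite enum_rankK_in.
Qed.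

Lemma incl_tr_eq (A : {set 'I_n}) (x y : 'rV[F]_n) :
    (forall j, j \notin A -> x 0 j = y 0 j) ->
    x *m (coord_incl A)^T = y *m (coord_incl A)^T ->
  x = y.
Proof.
move=> eq_xy; rewrite !mul_incl_tr => /rowP eqA; apply/rowP => j.
have [jA|/eq_xy //] := boolP (j \in A).
by have:= eqA (enum_rank_in jA j); rewrite !mxE enum_rankK_in.
Qed.

Lemma part_mul_H x : coord_part L x *m M *m (coord_incl H)^T = 0.
Proof.
rewrite mul_incl_tr; apply/rowP => j; rewrite !mxE big1 // => i _; rewrite !mxE.
case: ifP => iL; last by rewrite mul0r.
by rewrite M_LH ?mulr0 ?enum_valP.
Qed.

Lemma cpart_mul_Hc x j : j \notin H -> ((x - coord_part L x) *m M) 0 j = 0.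
Proof.
move=> jH; rewrite mxE big1 // => i _; rewrite !mxE.
case: ifP => [_|/negbT iL]; first by rewrite subrr mul0r.
by rewrite M_LcHc ?mulr0.
Qed.

(** Injectivity on column vectors supported in H means that the columns of M indexed by H are
    independent. *)
Lemma rank_mul_H : \rank (M *m (coord_incl H)^T) = #|H|.
Proof.
rewrite -mxrank_tr trmx_mul trmxK; apply/eqP/inj_row_free => v.
rewrite mulmxA => /(congr1 trmx); rewrite trmx_mul trmxK trmx0 => vM0.
have : (v *m coord_incl H)^T = 0.
  by apply: M_injH => // i iH; rewrite mxE mul_incl_supp.
move/(congr1 trmx)/(congr1 (mulmx^~ (coord_incl H)^T)).
by rewrite trmxK -mulmxA incl_incl_tr mulmx1 trmx0 mul0mx.
Qed.

(** Full rank on the columns in H gives x with x M = w there. Removing from x its part on L changes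
    nothing on H and makes the image vanish off H. *)
Lemma sub_of_supp (w : 'rV[F]_n) :
  (forall j, j \notin H -> w 0 j = 0) -> (w <= M)%MS.
Proof.
move=> wH; have : (w *m (coord_incl H)^T <= M *m (coord_incl H)^T)%MS.
  by apply: submx_full; rewrite /row_full rank_mul_H.
case/submxP => x; rewrite mulmxA => eq_w.
suff -> : w = (x - coord_part L x) *m M by apply: submxMl.
apply: (@incl_tr_eq H) => [j jH|]; first by rewrite wH // cpart_mul_Hc.
by rewrite mulmxBl mulmxBl part_mul_H subr0.
Qed.

(* The row space of M meets the kernel of the projection to the coordinates in H
   exactly in the span of the rows indexed by L. *)
Lemma rank_split : \rank M = (#|L| + #|H|)%N.
Proof.
rewrite -(mxrank_mul_ker M (coord_incl H)^T) rank_mul_H addnC; congr (_ + _)%N.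
have -> : \rank (M :&: kermx (coord_incl H)^T)%MS = \rank (coord_incl L *m M).
  apply: eqmx_rank; apply/andP; split.
    apply/rV_subP => w; rewrite sub_capmx => /andP[/submxP[x ->]] /sub_kermxP xMH.
    have -> : x *m M = coord_part L x *m M.
      apply: (@incl_tr_eq H) => [j jH|]; last by rewrite part_mul_H.
      move: (cpart_mul_Hc x jH); rewrite mulmxBl mxE [X in _ + X]mxE.
      by move/eqP; rewrite subr_eq0 => /eqP.
    exact/submxMr/part_sub.
  rewrite sub_capmx submxMl; apply/sub_kermxP/row_matrixP => i.
  rewrite row0 -mulmxA row_mul mulmxA -[RHS](part_mul_H (row i (coord_incl L))).
  congr (_ *m _ *m _); apply/rowP => j; rewrite !mxE.
  case: ifP => // /negbT jL; case: eqP => // ij.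
  by move: (enum_valP i); rewrite ij (negPf jL).
apply/eqP/inj_row_free => v; rewrite mulmxA => vM0.
have : v *m coord_incl L = 0 by apply: M_injL => // i iL; rewrite mul_incl_supp.
move/(congr1 (mulmx^~ (coord_incl L)^T)).
by rewrite -mulmxA incl_incl_tr mulmx1 mul0mx.
Qed.
End RankSplit.

(** * Counting the box points of degree 2q-3, 2q-2 or 2q-1 *)

Section MiddleDegrees.
Local Open Scope nat_scope.

(* The number of pairs (c, d) in [0, q - 1]^2 with c + d = s; the truncated
   subtraction gives 0 for s >= 2q - 1. *)
Definition tent q s := if s < q then s.+1 else 2 * q - s.+1.

Lemma sum_eq_add n (a s : nat) : \sum_(i < n) (a + i == s :> nat) = (a <= s < a + n).
Proof.
elim: n => [|n IHn]; first by rewrite big_ord0 addn0; lia.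
by rewrite big_ord_recr /= IHn; lia.
Qed.

Lemma sum_tent q s : \sum_(c < q) \sum_(d < q) (c + d == s :> nat) = tent q s.
Proof.
under eq_bigr => c _ do rewrite sum_eq_add.
(* The counted c below m form the interval s - q < c <= s, cut off at m. *)
suff: forall m, m <= q -> \sum_(c < m) (c <= s < c + q : nat) =
   minn m s.+1 - (s.+1 - q) by move=> -> //; rewrite /tent; case: ifP; lia.
elim=> [|m IHm] lt_mq; first by rewrite big_ord0; lia.
by rewrite big_ord_recr /= IHm; lia.
Qed.

(** The double sum counts the quadruples with a + b = c + d. Each row sum is quadratic in a; its
    negative terms are moved to the left to avoid truncated subtraction. *)
Lemma sum_tent_add q : 3 * \sum_(a < q) \sum_(b < q) tent q (a + b) = 2 * q ^ 3 + q.
Proof.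
have row a : a < q ->
    2 * \sum_(b < q) tent q (a + b) + 2 * a * (a + 1) =
    q * (q + 1) + 2 * a * q.
  (* With e = q - a, [tent] rises along the row for b < e and falls from b = e on. *)
  move=> /ltnW/subnK; move: (q - a) => e <-.
  have low m : m <= e ->
      2 * \sum_(b < m) tent (e + a) (a + b) = m * (2 * a + m + 1).
    elim: m => [|m IHm] lt_me; first by rewrite big_ord0.
    rewrite big_ord_recr /= mulnDr IHm ?(ltnW lt_me) //.
    by rewrite /tent (addnC e) ltn_add2l lt_me; lia.
  have high m : m <= a -> 2 * \sum_(b < e + m) tent (e + a) (a + b) + m * m =
      e * (2 * a + e + 1) + m * (a + a + 2 * e - 1).
    elim: m => [|m IHm] lt_ma; first by rewrite addn0 low; lia.
    rewrite addnS big_ord_recr /= mulnDr; have := IHm (ltnW lt_ma).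
    by rewrite /tent addnCA addnA ltnNge leq_addr /=; nia.
  have := high a (leqnn a); nia.
have : forall m, m <= q ->
    6 * \sum_(a < m) \sum_(b < q) tent q (a + b) + 2 * m * m * m + 3 * m * q =
    3 * m * q * (q + 1) + 3 * m * m * q + 2 * m.
  elim=> [|m IHm] lt_mq; first by rewrite big_ord0; lia.
  rewrite big_ord_recr /= mulnDr; have := row m lt_mq; have := IHm (ltnW lt_mq).
  set A := \sum_(i < m) _; set B := \sum_(b < q) _ => h1 h2; lia.
move/(_ q (leqnn q)); rewrite !expnS expn0; lia.
Qed.

(* The left-hand sum is [tent q] summed over the values 2q-3-(a+b), 2q-2-(a+b)
   and 2q-1-(a+b); the second difference of [tent q] is -2 at q-1 and 0 at the
   other values of a + b. *)
Lemma sum_near_antidiagonal q a b : a < q -> b < q ->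
  \sum_(c < q) \sum_(d < q) (2 * q <= a + b + (c + d) + 3 < 2 * q + 3 : nat)
  + 2 * (a + b == q - 1) = 3 * tent q (a + b).
Proof.
move=> lt_aq lt_bq.
(* The factor guards the corner a = b = q - 1, where 2q - 3 - (a + b) truncates to 0 and would
   wrongly count c = d = 0. *)
transitivity (\sum_(c < q) \sum_(d < q)
    ((a + b < 2 * q - 2) * (c + d == 2 * q - 3 - (a + b))
     + (c + d == 2 * q - 2 - (a + b)) + (c + d == 2 * q - 1 - (a + b)))
    + 2 * (a + b == q - 1)).
  congr (_ + _); apply: eq_bigr => c _; apply: eq_bigr => d _.
  by case: ltnP => ?; lia.
under eq_bigr => c _ do rewrite !big_split /= -big_distrr /=.
rewrite !big_split /= -big_distrr /= !sum_tent /tent.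
case: (ltnP (a + b) (2 * q - 2)) => ?; case: eqP => ?; do !case: ifP => ?; lia.
Qed.

(** The correction 2 in [sum_near_antidiagonal] occurs at the q points with a + b = q - 1, which
    turns 2q^3 + q into 2q^3 - q. *)
Lemma card_middle_quadruple q :
  \sum_(a < q) \sum_(b < q) \sum_(c < q) \sum_(d < q)
    (2 * q <= a + b + (c + d) + 3 < 2 * q + 3 : nat) = 2 * q ^ 3 - q.
Proof.
suff : \sum_(a < q) \sum_(b < q) \sum_(c < q) \sum_(d < q)
    (2 * q <= a + b + (c + d) + 3 < 2 * q + 3 : nat) + 2 * q = 2 * q ^ 3 + q by lia.
have diag : \sum_(a < q) \sum_(b < q) (a + b == q - 1) = q.
  rewrite -[RHS]card_ord -sum1_card; apply: eq_bigr => a _.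
  by rewrite sum_eq_add; move: (ltn_ord a); lia.
rewrite -sum_tent_add -[in X in _ + X = _]diag.
rewrite !big_distrr -big_split /=; apply: eq_bigr => a _.
rewrite !big_distrr -big_split /=; apply: eq_bigr => b _.
exact: sum_near_antidiagonal.
Qed.

End MiddleDegrees.

(** * Coefficients of monomial multiples, and quotients by ideals *)

Lemma mcoeffMX_le (R : nzRingType) n (p : {mpoly R[n]}) (m k : 'X_{1..n}) :
  (p * 'X_[m])@_k = if (m <= k)%MM then p@_(k - m) else 0.
Proof.
case: ifP => [le_mk|/negP nle_mk].
  by rewrite -{1}(submK le_mk) addmC mcoeffMX.
apply/eqP; rewrite mcoeff_eq0 (perm_mem (msuppMX p m)).
apply/mapP => -[m' _ eq_k]; apply: nle_mk; rewrite eq_k; exact: lem_addr.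
Qed.

Section Quotient.
Variables (k : fieldType) (A : comAlgType k) (r : nat) (g : r.-tuple A).

Lemma gen_ideal_mul (a : A) i : a * tnth g i \in gen_ideal g.
Proof.
apply/asboolP; exists (fun j => if j == i then a else 0).
by rewrite (bigD1 i) //= eqxx big1 ?addr0 // => j /negPf->; rewrite mul0r.
Qed.

Lemma pi_quot_gen_eq0 (p : A) : (\pi_(quot_gen g) p == 0) = (p \in gen_ideal g).
Proof.
have -> : 0 = \pi_(quot_gen g) 0
  by apply: (addrI (\pi_(quot_gen g) 0)); rewrite -pi_quot_genD !addr0.
by rewrite pi_quot_gen_eq subr0.
Qed.

(** First isomorphism theorem: the section [s] makes [phi] onto, and the induced map is [phi] on
    representatives. *)
Lemma has_dim_quot_gen n (phi : {linear A -> 'rV[k]_n}) (s : 'rV[k]_n -> A) :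
    cancel s phi -> (forall p, (p \in gen_ideal g) = (phi p == 0)) ->
  has_dim (quot_gen g) n.
Proof.
move=> sK ker_phi.
have phi_pi p p' : \pi_(quot_gen g) p = \pi_(quot_gen g) p' -> phi p = phi p'.
  by move/eqP; rewrite pi_quot_gen_eq ker_phi linearB subr_eq0 => /eqP.
constructor; exists (fun t => phi (repr t)).
  move=> c t u; rewrite -linearP; apply: phi_pi.
  by rewrite reprK pi_quot_genD reprK.
exists (fun w => \pi_(quot_gen g) (s w)) => [t|w].
  rewrite -[RHS]reprK; apply/eqP; rewrite pi_quot_gen_eq ker_phi linearB subr_eq0.
  by rewrite sK.
by rewrite -[RHS]sK; apply: phi_pi; rewrite reprK.
Qed.
End Quotient.

(** * Multiplication by f as a matrix on the box *)

Section Box.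
Variables (k : fieldType) (q : nat).
Local Notation box := {ffun 'I_4 -> 'I_q}.
Local Notation N := #|box|.

Definition mon (i : 'I_N) : 'X_{1..4} := [multinom (enum_val i l : nat) | l < 4].

Lemma mon_lt i l : (mon i l < q)%N.
Proof. by rewrite mnmE. Qed.

Lemma mon_inj : injective mon.
Proof.
move=> i j /mnmP eq_ij; apply: enum_val_inj; apply/ffunP => l.
by apply: val_inj; have := eq_ij l; rewrite !mnmE.
Qed.

Lemma mon_surj (m : 'X_{1..4}) : (forall l, (m l < q)%N) -> exists i, mon i = m.
Proof.
move=> lt_m; exists (enum_rank [ffun l => Ordinal (lt_m l)]).
by apply/mnmP => l; rewrite mnmE enum_rankK ffunE.
Qed.

Definition box_rev (i : 'I_N) : 'I_N :=
  enum_rank [ffun l => rev_ord (enum_val i l)].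

Lemma mon_rev i l : mon (box_rev i) l = (q - (mon i l).+1)%N.
Proof. by rewrite !mnmE enum_rankK ffunE. Qed.

Lemma box_revK : involutive box_rev.
Proof.
move=> i; apply: mon_inj; apply/mnmP => l; rewrite !mon_rev.
by move: (mon_lt i l); lia.
Qed.

Lemma mdeg_mon_rev i : (mdeg (mon (box_rev i)) + mdeg (mon i) + 4 = 4 * q)%N.
Proof.
rewrite !mdegE !big_ord_recl !big_ord0 !mon_rev.
have lt_i := mon_lt i; move: (lt_i ord0) (lt_i (lift ord0 ord0)).
move: (lt_i (lift ord0 (lift ord0 ord0))).
move: (lt_i (lift ord0 (lift ord0 (lift ord0 ord0)))).
lia.
Qed.

(* Row vectors list coefficients on the box, so [g *m mulM] is f * g reduced
   modulo the q-th powers of the variables. *)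
Definition mulM : 'M[k]_N :=
  \matrix_(i, j) \sum_l (face l + mon i == mon j)%MM%:R.

Lemma mdeg_face l : mdeg (face l) = 3%N.
Proof.
rewrite mdegE (bigD1 l) //= mnmE eqxx add0n.
rewrite (eq_bigr (fun=> 1%N)) => [|j /negPf ne]; last by rewrite mnmE ne.
by rewrite sum_nat_const muln1 cardC1 card_ord.
Qed.

Lemma mulM_eq0 i j : mdeg (mon j) != (mdeg (mon i) + 3)%N -> mulM i j = 0.
Proof.
move=> ne_ij; rewrite mxE big1 // => l _; case: eqP => // e.
by rewrite -e mdegD mdeg_face addnC eqxx in ne_ij.
Qed.

(** Reflection reverses arrows: v = u + [face l] iff rev u = rev v + [face l]. *)
Lemma mulM_rev i j : mulM (box_rev j) (box_rev i) = mulM i j.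
Proof.
rewrite !mxE; apply: eq_bigr => l _; congr (nat_of_bool _)%:R.
apply/idP/idP => /eqP/mnmP e; apply/eqP/mnmP => x.
  by move: (e x) (mon_lt i x) (mon_lt j x); rewrite !mnmDE !mon_rev; lia.
by move: (e x) (mon_lt i x) (mon_lt j x); rewrite !mnmDE !mon_rev; lia.
Qed.

(** Reflection exchanges the two sets. The 4 stands on the left so that [low_deg] is empty for q <=
    1. *)
Definition low_deg : {set 'I_N} := [set i | (mdeg (mon i) + 4 <= 2 * q)%N].
Definition high_deg : {set 'I_N} := [set i | (2 * q <= mdeg (mon i))%N].

Lemma mulM_injH (h : 'cV[k]_N) :
  (forall i, i \notin high_deg -> h i 0 = 0) -> mulM *m h = 0 -> h = 0.
Proof.
move=> supp_h Mh0.
(* [phi] extends [h] by zero outside the box; at a box point u the face relation is an entry of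
   [mulM *m h], and at other u all its terms are zero. *)
pose phi (m : 'X_{1..4}) : k := \sum_j h j 0 * (m == mon j)%:R.
have phi_mon j : phi (mon j) = h j 0.
  rewrite /phi (bigD1 j) //= eqxx mulr1 big1 ?addr0 // => j' ne_j.
  by rewrite (inj_eq mon_inj) eq_sym (negPf ne_j) mulr0.
have phi_out (m : 'X_{1..4}) l : (q <= m l)%N -> phi m = 0.
  move=> le_m; rewrite /phi big1 // => j _; case: eqP => [mj|].
    by move: (mon_lt j l); rewrite -mj ltnNge le_m.
  by rewrite mulr0.
have phi0 : forall m, phi m = 0.
  apply: (@face_sum_eq0 _ q) => [m nz_m|u].
    have lt_m l : (m l < q)%N by rewrite ltnNge; apply: contraNN nz_m => /phi_out->.
    split=> //; have [j mj] := mon_surj lt_m; rewrite -mj.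
    have: j \in high_deg; last by rewrite inE.
    by apply: contraNT nz_m => /supp_h hj; rewrite -mj phi_mon hj.
  have [/'forall_idP lt_u|] := boolP [forall l, u l < q]%N; last first.
    rewrite negb_forall => /existsP[l]; rewrite -leqNgt => le_u.
    rewrite big1 // => l' _; apply: (phi_out _ l); rewrite mnmDE; lia.
  have [i <-] := mon_surj lt_u.
  transitivity ((mulM *m h) i 0); last by rewrite Mh0 mxE.
  rewrite mxE /phi exchange_big; apply: eq_bigr => j _.
  by rewrite -mulr_sumr mulrC mxE.
by apply/colP => j; rewrite -phi_mon phi0 mxE.
Qed.

Lemma mulM_injL (g : 'rV[k]_N) :
  (forall i, i \notin low_deg -> g 0 i = 0) -> g *m mulM = 0 -> g = 0.
Proof.
move=> supp_g gM0; pose h : 'cV[k]_N := \col_i g 0 (box_rev i).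
have hE i : h i 0 = g 0 (box_rev i) by rewrite mxE.
suff h0 : h = 0.
  by apply/rowP => i; rewrite -[i]box_revK -hE h0 !mxE.
apply: mulM_injH => [i|].
  rewrite hE inE => lt_i; apply: supp_g; rewrite inE.
  by move: (mdeg_mon_rev i); lia.
apply/colP => i; transitivity ((g *m mulM) 0 (box_rev i)).
  rewrite mxE [RHS]mxE (reindex_inj (inv_inj box_revK)); apply: eq_bigr => j _.
  by rewrite hE box_revK -mulM_rev box_revK mulrC.
by rewrite gM0 !mxE.
Qed.

(** Degrees rise by 3: from at most 2q-4 they stay below 2q, from at least 2q-3 they reach 2q. *)
Lemma mulM_low_high i j : i \in low_deg -> j \in high_deg -> mulM i j = 0.
Proof. rewrite !inE => li hj; apply: mulM_eq0; lia. Qed.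

Lemma mulM_nlow_nhigh i j : i \notin low_deg -> j \notin high_deg -> mulM i j = 0.
Proof. rewrite !inE => li hj; apply: mulM_eq0; lia. Qed.

Lemma rank_mulM : \rank mulM = (#|low_deg| + #|high_deg|)%N.
Proof.
exact: (rank_split mulM_low_high mulM_nlow_nhigh mulM_injL mulM_injH).
Qed.

Lemma sum_box (F : nat -> nat) :
  (\sum_(i < N) F (mdeg (mon i)) =
   \sum_(a < q) \sum_(b < q) \sum_(c < q) \sum_(d < q) F (a + b + (c + d)))%N.
Proof.
pose o j := @inord 3 j.
pose h (t : 'I_q * 'I_q * ('I_q * 'I_q)) : box :=
  [ffun l => tnth [tuple t.1.1; t.1.2; t.2.1; t.2.2] l].
pose h' (u : box) := ((u (o 0%N), u (o 1%N)), (u (o 2%N), u (o 3%N))).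
have hK : cancel h h'.
  by case=> [[a b] [c d]]; rewrite /h' !ffunE !(tnth_nth a) !inordK.
have h'K : cancel h' h.
  move=> u; apply/ffunP => l; rewrite ffunE (tnth_nth (u l)).
  case: l => [[|[|[|[|//]]]] lt_l] /=; congr (u _); apply: val_inj;
    by rewrite /= inordK.
rewrite (reindex (@enum_rank box)); last by apply: onW_bij; exact: enum_rank_bij.
rewrite (reindex h); last by apply: onW_bij; exists h'.
rewrite [RHS]pair_bigA; under [RHS]eq_bigr => p _ do rewrite pair_bigA.
rewrite [RHS]pair_bigA; apply: eq_bigr => -[[a b] [c d]] _ /=.
congr F; rewrite mdegE !big_ord_recl big_ord0 !mnmE enum_rankK !ffunE.
by rewrite !(tnth_nth a) /=; lia.
Qed.

Lemma card_middle : (N - (#|low_deg| + #|high_deg|) = 2 * q ^ 3 - q)%N.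
Proof.
rewrite -card_middle_quadruple.
rewrite -(sum_box (fun s => (2 * q <= s + 3 < 2 * q + 3)%N : nat)).
have cardE (X : {set 'I_N}) : #|X| = (\sum_i (i \in X))%N.
  by rewrite -sum1_card big_mkcond; apply: eq_bigr => i _; case: ifP.
have : (\sum_(i < N) 1 = #|low_deg| + #|high_deg|
    + \sum_(i < N) (2 * q <= mdeg (mon i) + 3 < 2 * q + 3))%N.
  by rewrite !cardE -!big_split; apply: eq_bigr => i _; rewrite !inE /=; lia.
by rewrite sum1_card card_ord => {1}->; rewrite addKn.
Qed.
End Box.

(** * The ideal in box coordinates, the dimension of theta and its socle degree *)

Section Theta.
Variables (k : fieldType) (q : nat).
Local Notation N := #|{ffun 'I_4 -> 'I_q}|.
Local Notation S := {mpoly k[4]}.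

Definition theta_gens : 5.-tuple S :=
  [tuple cayley k; varX k ^+ q; varY k ^+ q; varZ k ^+ q; varW k ^+ q].
Local Notation I := (gen_ideal theta_gens).

Lemma theta_gens_var l : tnth theta_gens (lift ord0 l) = 'X_l ^+ q.
Proof.
rewrite (tnth_nth 0) /=.
by case: l => [[|[|[|[|//]]]] lt_l] /=; congr ('X_ _ ^+ q); apply: val_inj;
  rewrite /= inordK.
Qed.

Lemma faceE (a b c d : 'I_4) :
  uniq [:: a; b; c; d] -> face d = (U_(a) + U_(b) + U_(c))%MM.
Proof.
move=> uniq_abcd; apply/mnmP => j; rewrite !mnmDE !mnm1E mnmE.
have : j \in [:: a; b; c; d].
  rewrite (@uniq_min_size _ [:: a; b; c; d] (enum 'I_4)) ?mem_enum //.
    by move=> x _; rewrite mem_enum.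
  by rewrite size_enum_ord.
move: uniq_abcd; rewrite /= !inE !negb_or -!andbA.
move=> /and5P[ab ac ad bc /and3P[bd cd _]] /or4P[]/eqP->.
- by rewrite eqxx (eq_sym b) (eq_sym c) (negPf ab) (negPf ac) ad.
- by rewrite eqxx (eq_sym c) (negPf ab) (negPf bc) bd.
- by rewrite eqxx (negPf ac) (negPf bc) cd.
- by rewrite eqxx (negPf ad) (negPf bd) (negPf cd).
Qed.

Lemma inord4_eq i j :
  (i < 4)%N -> (j < 4)%N -> (inord i == inord j :> 'I_4) = (i == j).
Proof. by move=> lt_i lt_j; rewrite -val_eqE /= !inordK. Qed.

Lemma cayleyE : cayley k = \sum_l 'X_[face l].
Proof.
have -> : \sum_l 'X_[face l] = \sum_(0 <= l < 4) 'X_[face (inord l)] :> S.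
  by rewrite big_mkord; apply: eq_bigr => l _; rewrite inord_val.
rewrite !big_nat_recl // big_geq // addr0 /cayley /varX /varY /varZ /varW -!mpolyXD.
rewrite (@faceE (inord 1) (inord 2) (inord 3) (inord 0)) /= ?inE ?inord4_eq //.
rewrite (@faceE (inord 0) (inord 2) (inord 3) (inord 1)) /= ?inE ?inord4_eq //.
rewrite (@faceE (inord 0) (inord 1) (inord 3) (inord 2)) /= ?inE ?inord4_eq //.
rewrite (@faceE (inord 0) (inord 1) (inord 2) (inord 3)) /= ?inE ?inord4_eq //.
by rewrite addrC; congr (_ + _); rewrite addrC; congr (_ + _); rewrite addrC.
Qed.

Definition coefs (p : S) : 'rV[k]_N := \row_i p@_(mon i).

Lemma coefs_is_linear : linear coefs.
Proof. by move=> c p r; apply/rowP => i; rewrite !mxE mcoeffD mcoeffZ. Qed.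
HB.instance Definition _ :=
  GRing.isLinear.Build k S 'rV[k]_N _ coefs coefs_is_linear.

Definition box_poly (g : 'rV[k]_N) : S := \sum_i g 0 i *: 'X_[mon i].

Lemma box_polyK : cancel box_poly coefs.
Proof.
move=> g; apply/rowP => i; rewrite mxE /box_poly raddf_sum (bigD1 i) //=.
rewrite mcoeffZ mcoeffX eqxx mulr1 big1 ?addr0 // => j ne_j.
by rewrite mcoeffZ mcoeffX (inj_eq (@mon_inj q)) (negPf ne_j) mulr0.
Qed.

(** The box is closed under taking divisors, so coefficients of p outside it cannot contribute
    inside. *)
Lemma coefs_mul_cayley p : coefs (p * cayley k) = coefs p *m mulM k q.
Proof.
apply/rowP => j; rewrite !mxE cayleyE mulr_sumr raddf_sum /=.
under [RHS]eq_bigr => i _ do rewrite !mxE mulr_sumr.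
rewrite exchange_big; apply: eq_bigr => l _; rewrite mcoeffMX_le.
case: ifP => [le_lj|nle_lj].
  have lt_j x : ((mon j - face l)%MM x < q)%N.
    by rewrite mnmBE; move: (mon_lt j x); lia.
  have [i eq_i] := mon_surj lt_j.
  rewrite (bigD1 i) //= eq_i addmC submK // eqxx mulr1 big1 ?addr0 // => i' ne_i.
  case: eqP => [e|]; last by rewrite mulr0.
  case/eqP: ne_i; apply: mon_inj; rewrite eq_i -e addmC addmK //.
rewrite big1 // => i _; case: eqP => [e|]; last by rewrite mulr0.
by rewrite -e lem_addr in nle_lj.
Qed.

Lemma coefs_mul_var p l : coefs (p * 'X_l ^+ q) = 0.
Proof.
apply/rowP => j; rewrite !mxE mpolyXn mcoeffMX_le; case: ifP => // /mnm_lepP/(_ l).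
by rewrite mulmnE mnm1E eqxx mul1n leqNgt mon_lt.
Qed.

Lemma coefs0_ideal p : coefs p = 0 -> p \in I.
Proof.
move=> /rowP p0; rewrite [p]mpolyE big_seq; apply: rpred_sum => m m_p.
apply: rpredZ.
have [/'forall_idP lt_m|] := boolP [forall l, m l < q]%N.
  have [i mi] := mon_surj lt_m; have := p0 i; rewrite !mxE mi => pm0.
  by rewrite mcoeff_msupp pm0 eqxx in m_p.
rewrite negb_forall => /existsP[l]; rewrite -leqNgt => le_ml.
have -> : 'X_[m] = 'X_[m - U_(l) *+ q] * 'X_l ^+ q :> S.
  rewrite mpolyXn -mpolyXD submK //; apply/mnm_lepP => j.
  by rewrite mulmnE mnm1E; case: eqP => [<-|_]; rewrite ?mul1n ?mul0n.
by rewrite -theta_gens_var; apply: gen_ideal_mul.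
Qed.

(** Multiples of the q-th powers have no coefficients on the box, and those of f give the row space.
    Conversely, subtracting a suitable multiple of f from p clears the box. *)
Lemma ideal_coefs p : (p \in I) = (coefs p <= mulM k q)%MS.
Proof.
apply/idP/idP => [/asboolP[a ->]|/submxP[v eq_v]].
  rewrite big_ord_recl linearD linear_sum /= big1 => [|l _].
    by rewrite addr0 (tnth_nth 0) /= coefs_mul_cayley submxMl.
  by rewrite theta_gens_var coefs_mul_var.
rewrite -[p](subrK (box_poly v * cayley k)) rpredD //; last first.
  exact: (gen_ideal_mul theta_gens _ ord0).
by apply: coefs0_ideal; rewrite linearB /= coefs_mul_cayley box_polyK eq_v subrr.
Qed.

Lemma has_dim_theta : has_dim (theta k q) (2 * q ^ 3 - q).
Proof.
rewrite -card_middle -(rank_mulM k) -mxrank_coker.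
(* Multiplication by [C] is onto, as [C] has full column rank, and has the same kernel as the
   cokernel matrix, namely the row space of [mulM]. *)
set C := col_base (cokermx (mulM k q)).
apply: (@has_dim_quot_gen k S _ theta_gens _ (mulmxr C \o coefs)
  (fun w => box_poly (w *m pinvmx C))) => [w|p].
  by rewrite /= box_polyK mulmxKpV // submx_full ?col_base_full.
rewrite ideal_coefs submxE /= -{1}(mulmx_base (cokermx _)) mulmxA.
by rewrite mulmx_free_eq0 ?row_base_free.
Qed.

Lemma theta_neq0P i :
  theta_neq0 k q i <-> exists2 p : S, p \is i.-homog & p \notin I.
Proof.
split=> [[t [p hom_p ->]]|[p hom_p p_I]].
  by rewrite /in_theta pi_quot_gen_eq0 => p_I; exists p.
by exists (in_theta q p); [exists p | rewrite /in_theta pi_quot_gen_eq0].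
Qed.

Lemma homog_ideal_high i p : (2 * q <= i)%N -> p \is i.-homog -> p \in I.
Proof.
move=> le_i hom_p; rewrite ideal_coefs.
apply: (sub_of_supp (@mulM_low_high k q) (@mulM_nlow_nhigh k q) (@mulM_injH k q)).
move=> j; rewrite inE mxE => lt_j; apply: (dhomog_nemf_coeff hom_p).
by apply: contraNneq lt_j => /= ->.
Qed.

Lemma socle_degree1 : q = 1%N -> socle_degree k q 0.
Proof.
move=> q1; split.
  apply/theta_neq0P; exists 1; first exact: dhomog1.
  rewrite ideal_coefs; apply/negP => /submxP[v].
  (* For q = 1 the box is the origin alone, and no product with f stays in it. *)
  have mulM0 : mulM k q = 0.
    apply/matrixP => i j; rewrite [RHS]mxE mulM_eq0 //.
    have mdeg0 (s : 'I_N) : mdeg (mon s) = 0%N.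
      by rewrite mdegE big1 // => l _; move: (mon_lt s l); lia.
    by rewrite !mdeg0.
  rewrite mulM0 mulmx0 => /rowP.
  have lt0 (l : 'I_4) : ((0%MM : 'X_{1..4}) l < q)%N by rewrite mnm0E q1.
  have [i i0] := mon_surj lt0.
  by move/(_ i)/eqP; rewrite !mxE i0 mcoeff1 eqxx oner_eq0.
move=> i /theta_neq0P[p hom_p]; apply: contraNT; rewrite -ltnNge => i_gt0.
apply: coefs0_ideal; apply/rowP => j; rewrite !mxE.
apply: (dhomog_nemf_coeff hom_p).
rewrite /= mdegE big1 => [|l _]; first by rewrite eq_sym -lt0n.
by move: (mon_lt j l); lia.
Qed.

Lemma socle_degree_gt1 : (1 < q)%N -> socle_degree k q (2 * q - 1).
Proof.
move=> q_gt1; split; last first.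
  move=> i /theta_neq0P[p hom_p]; apply: contraNT; rewrite -ltnNge => lt_i.
  by apply: homog_ideal_high hom_p; lia.
(* [m 2] and [m 3] are the exponents of (xy)^(q-1) z and (xy)^(q-1) w; of the
   four monomials of f, only [face (5 - j)] divides ['X_[m j]]. *)
pose o j : 'I_4 := inord j.
pose e : 'X_{1..4} := (U_(o 0%N) + U_(o 1%N))%MM.
pose m j : 'X_{1..4} := (e *+ q.-1 + U_(o j))%MM.
have mE j x : (1 < j < 4)%N -> (x < 4)%N ->
    m j (o x) = (if (x < 2)%N then q.-1 else (x == j))%N.
  move=> j23 lt_x; rewrite mnmDE mulmnE mnmDE !mnm1E !inord4_eq //; last lia.
  by case: x lt_x j23 => [|[|x]] /=; lia.
have lt_m j x : (1 < j < 4)%N -> (m j x < q)%N.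
  move=> j23; rewrite -[x]inord_val mE //; case: ifP => _; first lia.
  exact: leq_ltn_trans (leq_b1 _) q_gt1.
have mcoeff_pow j p l : (1 < j < 4)%N -> (p * 'X_l ^+ q)@_(m j) = 0 :> k.
  move=> j23; rewrite mpolyXn mcoeffMX_le; case: ifP => // /mnm_lepP/(_ l).
  by rewrite mulmnE mnm1E eqxx mul1n leqNgt lt_m.
(* The right-hand side, the coefficient at (xy)^(q-2), is the same for j = 2 and j = 3; the map j to
   5 - j swaps z and w. *)
have mcoeff_cayley j p : (1 < j < 4)%N ->
    (p * cayley k)@_(m j) = p@_(e *+ q.-2) :> k.
  move=> j23; rewrite cayleyE mulr_sumr raddf_sum.
  rewrite (bigD1 (o (5 - j)%N)) //= big1 => [|l ne_l].
    rewrite addr0.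
    have -> : m j = (face (o (5 - j)%N) + e *+ q.-2)%MM.
      rewrite (@faceE (o 0%N) (o 1%N) (o j)) /= ?inE ?inord4_eq; try lia.
      rewrite /m -/e (_ : q.-1 = q.-2.+1); last lia.
      by rewrite mulmS -!addmA (addmC (e *+ _)%MM).
    exact: mcoeffMX.
  rewrite mcoeffMX_le; case: ifP => // /mnm_lepP/(_ (o (5 - j)%N)).
  rewrite mE //; last lia.
  rewrite mnmE eq_sym ne_l.
  have -> : (5 - j < 2)%N = false by lia.
  by have -> : (5 - j == j)%N = false by lia.
have m2_neq_m3 : m 2%N != m 3%N.
  by apply/negP => /eqP/mnmP/(_ (o 2%N)); rewrite !mE.
have ideal_mcoeff p : p \in I -> p@_(m 2%N) = p@_(m 3%N).
  move=> /asboolP[a ->]; rewrite big_ord_recl !mcoeffD !raddf_sum /=.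
  rewrite !big1 => [|l _|l _]; try by rewrite theta_gens_var mcoeff_pow.
  by rewrite (tnth_nth 0) /= !mcoeff_cayley.
apply/theta_neq0P; exists 'X_[m 2%N].
  by rewrite dhomogX /= !(mdegD, mdegMn, mdeg1); lia.
apply/negP => /ideal_mcoeff/eqP.
by rewrite !mcoeffX eqxx (negPf m2_neq_m3) oner_eq0.
Qed.
End Theta.

End CayleyCubic.

Theorem theorem7 (k : fieldType) (q : nat) :
  [/\ q = 1 -> socle_degree k q 0,
      1 < q -> socle_degree k q (2 * q - 1)
    & has_dim (theta k q) (2 * q ^ 3 - q)].
Proof.
split; [exact: socle_degree1 | exact: socle_degree_gt1 | exact: has_dim_theta].
Qed.
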